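(* Let $\mathcal{G}=(\mathcal{V},\mathcal{E})$ be a rooted temporal tree with root $r$ in which every edge is associated with exactly one time interval. Then Algorithm A (described in the context), run on $\mathcal{G}$ and $r$, outputs a maximum 0-1 timed matching for $\mathcal{G}$.
   Context: A temporal graph $\mathcal{G}=(\mathcal{V},\mathcal{E})$ with lifetime $\mathcal{T}$ has a finite node set $\mathcal{V}$ and a finite edge set $\mathcal{E}$; each edge joins two distinct nodes (at most one edge per pair) and is associated with a nonempty list of time intervals $[s_1,f_1),\dots,[s_k,f_k)$, integers $0\le s_1<f_1<s_2<\dots<s_k<f_k\le\mathcal{T}$; it exists at each integer timestep in one of these intervals. The underlying graph is the static graph on $\mathcal{V}$ with an edge $\{u,v\}$ for each temporal edge between $u,v$. A rooted temporal tree is a temporal graph whose underlying graph is a tree, with a designated root $r$; $P(v)$ is the parent of $v\ne r$, $child(v)$ its set of children, depth is distance from $r$ in the underlying graph, and $T_v$ is the temporal subtree on $v$ and its descendants. Two distinct edges overlap if they share an endpoint and exist at a common timestep. A 0-1 timed matching is a set of edges no two of which overlap; a maximum one has maximum cardinality. For a set $S$ of edges, $MaxNOS(S)$ denotes some maximum-cardinality subset of $S$ with no two edges overlapping. Algorithm A: If $r$ has no children, output $\emptyset$. Otherwise process the nodes in non-increasing order of depth. For a leaf $u$, set $M_u:=\emptyset$. For a non-leaf $v$ with children $u_1,\dots,u_k$ (already processed): (i) $TM1[v]:=M_{u_1}\cup\dots\cup M_{u_k}$; (ii) let $\tilde{\mathcal{R}}_0(v)$ be the set of edges $e_{vu_i}$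 ($u_i\in child(v)$) such that no edge of $M_{u_i}$ overlaps $e_{vu_i}$; if $\tilde{\mathcal{R}}_0(v)=\emptyset$ set $F_v:=\emptyset$; else if $v=r$ set $F_v:=MaxNOS(\tilde{\mathcal{R}}_0(v))$; else let $\tilde{\mathcal{R}}^P_0(v):=\tilde{\mathcal{R}}_0(v)\cup\{e_{vP(v)}\}$ and set $F_v:=MaxNOS(\tilde{\mathcal{R}}^P_0(v))\setminus\{e_{vP(v)}\}$ if $|MaxNOS(\tilde{\mathcal{R}}^P_0(v))|>|MaxNOS(\tilde{\mathcal{R}}_0(v))|$, and $F_v:=MaxNOS(\tilde{\mathcal{R}}_0(v))$ otherwise; (iii) $TM2[v]:=\emptyset$ if $F_v=\emptyset$, else $TM2[v]:=TM1[v]\cup F_v$; (iv) $M_v:=$ whichever of $TM1[v],TM2[v]$ has larger cardinality (either if equal). Output $M_r$. *)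

(* Defs.v *)
From mathcomp Require Import all_boot.

Set Implicit Arguments.
Unset Strict Implicit.
Unset Printing Implicit Defensive.

(* An item (s, f) stands for the interval [s, f); the sorted condition reads
   s_1 < f_1 < s_2 < ... < s_k < f_k. *)
Definition interval_list (T : nat) (l : seq (nat * nat)) : bool :=
  [&& l != [::],
      sorted ltn (flatten [seq [:: i.1; i.2] | i <- l])
    & all (fun i => i.2 <= T) l].

(* Edges are two-element sets of nodes, so there is at most one per pair.
   The value of [intervals] outside [edges] is irrelevant. *)
Record temporal_graph (V : finType) := TemporalGraph {
  lifetime : nat;
  edges : {set {set V}};
  intervals : {set V} -> seq (nat * nat);
  edge_card : forall e, e \in edges -> #|e| = 2;
  edge_intervals : forall e, e \in edges -> interval_list lifetime (intervals e)
}.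

Section TemporalGraph.

Variables (V : finType) (G : temporal_graph V).

Definition exists_at (e : {set V}) (t : nat) : bool :=
  has (fun i => i.1 <= t < i.2) (intervals G e).

Definition overlap (e f : {set V}) : bool :=
  [&& e != f, e :&: f != set0
    & [exists t : 'I_(lifetime G), exists_at e t && exists_at f t]].

Definition nonoverlapping (S : {set {set V}}) : bool :=
  [forall e in S, forall f in S, ~~ overlap e f].

Definition timed_matching (M : {set {set V}}) : bool :=
  (M \subset edges G) && nonoverlapping M.

Definition maximum_timed_matching (M : {set {set V}}) : Prop :=
  timed_matching M /\ forall M', timed_matching M' -> #|M'| <= #|M|.

Definition is_maxNOS (S X : {set {set V}}) : Prop :=
  [/\ X \subset S, nonoverlapping X &
      forall Y : {set {set V}}, Y \subset S -> nonoverlapping Y -> #|Y| <= #|X|].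

(* Adjacency in the underlying graph; irreflexive by [edge_card]. *)
Definition adj : rel V := [rel u v | [set u; v] \in edges G].

(* Connected, and without cycles: [ucycle] also holds of an edge traversed
   back and forth, whence the bound 2. *)
Definition temporal_tree : Prop :=
  (forall u v, connect adj u v) /\ (forall c, ucycle adj c -> size c <= 2).

(* The least length of a walk from u to v; in a connected graph it is < #|V|,
   so the search succeeds. *)
Definition dist (u v : V) : nat :=
  find (fun n => [exists p : n.-tuple V, path adj u p && (last u p == v)])
       (iota 0 #|V|).

Variable r : V.

Definition depth (v : V) : nat := dist r v.

Definition child (v : V) : {set V} :=
  [set u | adj v u && (depth u == (depth v).+1)].

(* The default value v is only taken at the root. *)
Definition parent (v : V) : V := odflt v [pick p | v \in child p].

Definition processing_order (s : seq V) : Prop :=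
  perm_eq s (enum V) /\ sorted (fun u v => depth v <= depth u) s.

Section AlgorithmA.

(* The algorithm is nondeterministic: [maxNOS] resolves the choice of a maximum
   non-overlapping subset, and [tie v] the choice between TM1[v] and TM2[v] when
   they have the same cardinality. *)
Variables (maxNOS : {set {set V}} -> {set {set V}}) (tie : V -> bool).

(* [M u] is the matching M_u computed for an already processed node u. *)
Section Step.

Variables (M : V -> {set {set V}}) (v : V).

Definition TM1 : {set {set V}} := \bigcup_(u in child v) M u.

Definition R0 : {set {set V}} :=
  [set [set v; u] | u in child v & [forall f in M u, ~~ overlap f [set v; u]]].

Definition RP0 : {set {set V}} := R0 :|: [set [set v; parent v]].

Definition F : {set {set V}} :=
  if R0 == set0 then set0
  else if v == r then maxNOS R0
  else if #|maxNOS R0| < #|maxNOS RP0| then maxNOS RP0 :\ [set v; parent v]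
  else maxNOS R0.

Definition TM2 : {set {set V}} := if F == set0 then set0 else TM1 :|: F.

Definition node_matching : {set {set V}} :=
  if child v == set0 then set0
  else if #|TM2| < #|TM1| then TM1
  else if #|TM1| < #|TM2| then TM2
  else if tie v then TM1 else TM2.

Definition process : V -> {set {set V}} :=
  fun w => if w == v then node_matching else M w.

End Step.

(* The initial values set0 are never read when children come before their
   parents in the order s. *)
Definition algorithmA (s : seq V) : {set {set V}} :=
  if child r == set0 then set0
  else foldl process (fun=> set0) s r.

End AlgorithmA.

End TemporalGraph.

(* Main.v *)
Require Import Defs.
From mathcomp Require Import all_boot.

Set Implicit Arguments.
Unset Strict Implicit.
Unset Printing Implicit Defensive.

(** For a node v <> r call a maximum matching of T_v safe if no edge of it
    overlaps the edge from v to its parent. By induction from the leaves, M_v is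
    a maximum matching of T_v, and it is safe as soon as T_v has a safe maximum
    matching. Indeed, if a matching Y of T_v uses an edge e = vu which M_u
    overlaps, then Y restricted to T_u avoids e, so by the induction hypothesis
    it has fewer edges than M_u: trading e for an edge of T_u loses nothing.
    Hence |Y| <= |TM1[v]| + |Y :&: R0(v)|, and TM1[v] :|: F_v reaches the
    largest possible value of the right-hand side. The only edges of it that
    can overlap the parent edge are those of F_v, whose choice is safe whenever
    a largest choice can be. *)

(** * Cardinalities of indexed unions *)

Section CardBigcup.

Variables (I T : finType) (A : {set I}) (B : I -> {set T}).

Lemma leq_card_bigcup : #|\bigcup_(i in A) B i| <= \sum_(i in A) #|B i|.
Proof.
elim/big_rec2: _ => [|i n S _ leS]; first by rewrite cards0.
by apply: leq_trans (leq_card_setU _ _) _; rewrite leq_add2l.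
Qed.

Lemma card_bigcup_disjoint :
  {in A &, forall i j, i != j -> [disjoint B i & B j]} ->
  #|\bigcup_(i in A) B i| = \sum_(i in A) #|B i|.
Proof.
(* The library lemma asks for disjointness over all indices, so the family is extended by [set0]
   outside [A]. *)
move=> disjB; rewrite big_mkcond -sum1_card partition_disjoint_bigcup.
  by rewrite [RHS]big_mkcond; apply: eq_bigr => i _; case: ifP => _;
     rewrite sum1_card ?cards0.
move=> i j nij; case: ifP => iA; last by rewrite -setI_eq0 set0I.
by case: ifP => jA; [apply: disjB | rewrite -setI_eq0 setI0].
Qed.

End CardBigcup.

(** * Distances and depths *)

Section Distance.

Variables (V : finType) (G : temporal_graph V).
Hypothesis connG : forall u v, connect (adj G) u v.

Lemma adj_sym : symmetric (adj G).
Proof. by move=> u v; rewrite /adj /= setUC. Qed.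

Lemma adj_irrefl : irreflexive (adj G).
Proof.
move=> u; apply/negP => /= /edge_card.
by rewrite setUid cards1.
Qed.

(** A duplicate-free walk has fewer than [#|V|] steps, so the search defining [dist] succeeds and
    its result is a length that is attained. *)
Lemma dist_path u v :
  exists p, [/\ path (adj G) u p, last u p = v & size p = dist G u v].
Proof.
set P := fun n => [exists p : n.-tuple V, path (adj G) u p && (last u p == v)].
have hasP : has P (iota 0 #|V|).
  have /connectP [p0 pth0 lst0] := connG u v.
  have [p pth uniq_p] : exists2 p, path (adj G) u p /\ last u p = v & uniq (u :: p).
    by rewrite lst0; have [p *] := shortenP pth0; exists p.
  apply/hasP; exists (size p).
    by rewrite mem_iota /= add0n (leq_trans _ (max_card (mem (u :: p)))) //
               (card_uniqP uniq_p).
  by apply/existsP; exists (in_tuple p) => /=; rewrite pth.1 pth.2 eqxx.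
have := nth_find 0 hasP.
rewrite -/(dist G u v) nth_iota; last by move: hasP; rewrite has_find size_iota.
rewrite add0n => /existsP [p /andP [pth /eqP lst]].
by exists p; rewrite size_tuple.
Qed.

Lemma dist_le_path u p : path (adj G) u p -> dist G u (last u p) <= size p.
Proof.
move=> pth; rewrite leqNgt; apply/negP => lt_p.
have lt_pV : size p < #|V|.
  apply: leq_trans lt_p _; rewrite -[X in _ <= X](size_iota 0).
  exact: find_size.
have := before_find 0 lt_p; rewrite nth_iota // add0n => /existsP [].
by exists (in_tuple p); rewrite pth eqxx.
Qed.

Lemma dist_adj u v w : adj G v w -> dist G u w <= (dist G u v).+1.
Proof.
move=> vw; have [p [pth lst sz]] := dist_path u v.
have := @dist_le_path u (rcons p w).
by rewrite rcons_path pth lst vw last_rcons size_rcons sz => /(_ isT).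
Qed.

Lemma dist_refl u : dist G u u = 0.
Proof. by apply/eqP; rewrite -leqn0; apply: (@dist_le_path u [::]). Qed.

Lemma dist_pred u w : w != u -> exists2 v, adj G v w & dist G u w = (dist G u v).+1.
Proof.
have [p] := dist_path u w.
case/lastP: p => [[_ /= -> _]|p x []]; first by rewrite eqxx.
rewrite rcons_path last_rcons size_rcons => /andP [pth adjx] <- sz _.
exists (last u p) => //; apply/eqP; rewrite eqn_leq dist_adj //= -sz ltnS.
exact: dist_le_path.
Qed.

End Distance.

(** * Rooted trees *)

Section RootedTree.

Variables (V : finType) (G : temporal_graph V) (r : V).
Hypothesis treeG : temporal_tree G.

Let connG : forall u v, connect (adj G) u v := treeG.1.

(** The graph with [x] deleted; [x] stays in the type as an isolated node. *)
Definition avoid (x : V) : rel V := [rel u v | [&& adj G u v, u != x & v != x]].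

Lemma avoid_sym x : connect_sym (avoid x).
Proof.
apply: sym_connect_sym => u v.
by rewrite /avoid /= adj_sym [(u != x) && _]andbC.
Qed.

(** The form in which acyclicity is used: a simple path from [a] to [b] avoiding [x] closes up
    through [x] to a cycle, which has at least three nodes unless the path is empty. *)
Lemma neighbours_separated x a b :
  adj G x a -> adj G x b -> connect (avoid x) a b -> a = b.
Proof.
move=> xa xb /connectP [p0 pth0 lst0].
have [p [pth uniq_p lst]] : exists p,
    [/\ path (avoid x) a p, uniq (a :: p) & b = last a p].
  by rewrite lst0; have [p *] := shortenP pth0; exists p.
have nxa : a != x by apply/eqP => eax; rewrite eax adj_irrefl in xa.
have [pthG xNp] : path (adj G) a p /\ x \notin p.
  elim: p a nxa pth {xa lst0 lst pth0 uniq_p} => //= y p IH a nxa.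
  case/andP => /and3P [ay _ nyx] /(IH y nyx) [-> xNp].
  by rewrite ay inE eq_sym negb_or nyx.
have [_ /(_ (x :: a :: p))] := treeG.
rewrite /ucycle /= rcons_path -lst xa pthG (adj_sym G b x) xb /=.
rewrite inE negb_or eq_sym nxa xNp -[(a \notin p) && _]/(uniq (a :: p)) uniq_p.
by case: p lst {pth uniq_p pthG xNp} => [//|y p _ /(_ isT)].
Qed.

Lemma depth_root : depth G r r = 0.
Proof. exact: dist_refl. Qed.

(** Along a shortest walk from [r] to [w], every node before [w] is strictly shallower than [w],
    hence also than [x]. *)
Lemma connect_root_avoid x w :
  w != x -> depth G r w <= depth G r x -> connect (avoid x) r w.
Proof.
have [n] := ubnP (depth G r w); elim: n w => // n IH w ltwn nwx lewx.
have [->|nwr] := eqVneq w r; first exact: connect0.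
have [p pw dp] := dist_pred connG nwr.
have ltp : depth G r p < depth G r w by rewrite /depth dp.
have npx : p != x by apply: contraTneq ltp => ->; rewrite -leqNgt.
apply: (@connect_trans _ _ p).
  by apply: IH; rewrite ?(leq_trans ltp) // ltnW // (leq_trans ltp).
by apply: connect1; rewrite /avoid /= pw npx.
Qed.

(** If the depths were equal, [b] and a predecessor [p] of [a] would be two neighbours of [a] joined
    through [r] without meeting [a]. Then [p = b], although [p] is shallower. *)
Lemma depth_adj_neq a b : adj G a b -> depth G r a != depth G r b.
Proof.
move=> ab; apply/eqP => dab.
have nab : b != a by apply/eqP => eab; rewrite eab adj_irrefl in ab.
have nar : a != r.
  apply: contraNneq nab => ar; rewrite ar; apply/negPn/negP => nbr.
  have [p _ dp] := dist_pred connG nbr.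
  by move: dab; rewrite ar depth_root /depth dp.
have [p pa dp] := dist_pred connG nar.
have ltp : depth G r p < depth G r a by rewrite /depth dp.
have npa : p != a by apply: contraTneq ltp => ->; rewrite ltnn.
have epb : p = b.
  apply: (@neighbours_separated a) => //; first by rewrite adj_sym.
  apply: (@connect_trans _ _ r); first rewrite avoid_sym.
    by apply: connect_root_avoid => //; apply: ltnW.
  by apply: connect_root_avoid => //; rewrite dab.
by move: ltp; rewrite epb dab ltnn.
Qed.

Lemma child_unique p q v : v \in child G r p -> v \in child G r q -> p = q.
Proof.
rewrite !inE => /andP [pv /eqP dp] /andP [qv /eqP dq].
have away w : depth G r v = (depth G r w).+1 -> connect (avoid v) r w.
  move=> dw; apply: connect_root_avoid; last by rewrite dw.
  by apply/eqP => ewv; move: dw; rewrite ewv => /n_Sn.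
apply: (@neighbours_separated v); rewrite 1?adj_sym //.
by apply: connect_trans (away _ dq); rewrite avoid_sym away.
Qed.

Notation par := (parent G r).

Lemma root_notin_child v : r \notin child G r v.
Proof. by rewrite inE depth_root andbF. Qed.

Lemma child_parent v : v != r -> v \in child G r (par v).
Proof.
move=> nvr; rewrite /parent; case: pickP => //= noparent.
have [p pv dp] := dist_pred connG nvr.
by have := noparent p; rewrite inE pv /depth dp eqxx.
Qed.

Lemma parent_child v u : u \in child G r v -> par u = v.
Proof.
move=> uv; apply: (child_unique _ uv); apply: child_parent.
by apply: contraTneq uv => ->; apply: root_notin_child.
Qed.

(** The default value in [parent] makes [r] a fixed point, so a climb by [par] that reaches [r]
    stays there. *)
Lemma parent_root : par r = r.
Proof.
by rewrite /parent; case: pickP => //= p; rewrite (negPf (root_notin_child p)).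
Qed.

Lemma depth_child v u : u \in child G r v -> depth G r u = (depth G r v).+1.
Proof. by rewrite inE => /andP [_ /eqP]. Qed.

Lemma depth_parent v : depth G r (par v) <= depth G r v.
Proof.
have [->|nvr] := eqVneq v r; first by rewrite parent_root.
by rewrite (depth_child (child_parent nvr)).
Qed.

Lemma depth_ancestor v w : fconnect par w v -> depth G r v <= depth G r w.
Proof.
move=> /iter_findex <-; elim: findex => //= n IH.
exact: leq_trans (depth_parent _) IH.
Qed.

Lemma ancestor_root w : fconnect par w r.
Proof.
have [n] := ubnP (depth G r w); elim: n w => // n IH w ltwn.
have [->|nwr] := eqVneq w r; first exact: connect0.
apply: connect_trans (fconnect1 _ _) (IH _ _).
by rewrite (depth_child (child_parent nwr)) in ltwn.
Qed.

(** * Subtrees and their edges *)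

Definition subtree (v : V) : {set V} := [set w | fconnect par w v].

Definition subtree_edges (v : V) : {set {set V}} :=
  [set e in edges G | e \subset subtree v].

Lemma subtree_edges_sub v : subtree_edges v \subset edges G.
Proof. by apply/subsetP => e; rewrite inE => /andP []. Qed.

Lemma subtree_edges_root : subtree_edges r = edges G.
Proof.
apply/setP => e; rewrite inE andb_idr // => _.
by apply/subsetP => w _; rewrite inE ancestor_root.
Qed.

Lemma notin_subtree v w : depth G r w < depth G r v -> w \notin subtree v.
Proof. by apply: contraTN; rewrite inE -leqNgt => /depth_ancestor. Qed.

(** A climb from [u] to [w] of at least one step passes through [v] first, and nothing reached from
    [v] is as deep as [w]. *)
Lemma child_notin_subtree v u w :
  u \in child G r v -> w \in child G r v -> u != w -> u \notin subtree w.
Proof.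
move=> uv wv; apply: contra; rewrite inE => /iter_findex.
case: findex => [/= -> //|n]; rewrite iterSr (parent_child uv) => eqw.
suff: depth G r w <= depth G r v by rewrite (depth_child wv) ltnn.
by rewrite -eqw; apply/depth_ancestor/fconnect_iter.
Qed.

(** The ancestors of a common node [x] form a single chain under [par], so one of [u], [w] would lie
    in the subtree of the other. *)
Lemma subtree_disjoint v u w :
  u \in child G r v -> w \in child G r v -> u != w ->
  [disjoint subtree u & subtree w].
Proof.
move=> uv wv nuw; apply/pred0P => x /=; apply/negP; rewrite !inE.
case/andP => /iter_findex; move: (findex _ _ _) => i ei /iter_findex.
move: (findex _ _ _) => j ej.
wlog leij : u w uv wv nuw i j ei ej / i <= j.
  by case/orP: (leq_total i j) => ? H; [apply: (H u w) ei ej _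
    | apply: (H w u) ej ei _] => //; rewrite eq_sym.
have := child_notin_subtree uv wv nuw.
by rewrite inE -ej -(subnK leij) iterD ei fconnect_iter.
Qed.

Lemma subtree_child v x :
  x \in subtree v -> x != v -> exists2 u, u \in child G r v & x \in subtree u.
Proof.
rewrite inE => /iter_findex; move: (findex _ _ _) => i.
elim: i => /= [->|i IH ei nxv]; first by rewrite eqxx.
(* The climb may stay at [v] when [v] is the root, so the wanted child is the last node before [v]
   is first reached. *)
have [eiv|niv] := eqVneq (iter i par x) v; first exact: IH.
exists (iter i par x); last by rewrite inE fconnect_iter.
rewrite -{1}ei; apply: child_parent.
by apply: contraNneq niv => eir; rewrite -ei eir parent_root.
Qed.

Lemma edge_child e :
  e \in edges G -> exists a b, b \in child G r a /\ e = [set a; b].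
Proof.
move=> eG; have /eqP/cards2P [a [b [nab eab]]] := edge_card eG.
have ab : adj G a b by rewrite /adj /= -eab.
have ba : adj G b a by rewrite adj_sym.
have := depth_adj_neq ab; rewrite neq_ltn => /orP [] lt_d.
  exists a, b; split=> //; rewrite inE ab eqn_leq lt_d andbT.
  exact: dist_adj.
exists b, a; split; last by rewrite setUC.
by rewrite inE ba eqn_leq lt_d andbT; apply: dist_adj.
Qed.

Lemma child_edge v u : u \in child G r v -> [set v; u] \in edges G.
Proof. by rewrite inE => /andP []. Qed.

Lemma child_edge_inj v : {in child G r v &, injective (fun u => [set v; u])}.
Proof.
move=> u w uv wv /setP /(_ u).
rewrite !inE eqxx orbT => /esym /orP [/eqP euv|/eqP //].
by have := depth_child uv; rewrite euv => /n_Sn.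
Qed.

Lemma subtree_edges_child v u :
  u \in child G r v -> subtree_edges u \subset subtree_edges v.
Proof.
move=> uv; apply/subsetP => e; rewrite !inE => /andP [-> /subsetP sub].
apply/subsetP => x /sub; rewrite !inE => xu.
by rewrite (connect_trans xu) // -(parent_child uv) fconnect1.
Qed.

Lemma child_edge_subtree v u :
  u \in child G r v -> [set v; u] \in subtree_edges v.
Proof.
move=> uv; rewrite inE child_edge //=; apply/subsetP => x; rewrite !inE.
by case/orP => /eqP ->; rewrite ?connect0 // -(parent_child uv) fconnect1.
Qed.

Lemma child_edge_subtreeW v u w : [set v; u] \in subtree_edges w -> v \in subtree w.
Proof. by rewrite inE => /andP [_ /subsetP]; apply; rewrite !inE eqxx. Qed.

(** The upper endpoint [a] decides: either it is [v], or it lies below some child of [v], and then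
    so does the lower endpoint. *)
Lemma subtree_edges_cases v e :
  e \in subtree_edges v ->
  (exists2 u, u \in child G r v & e = [set v; u]) \/
  (exists2 u, u \in child G r v & e \in subtree_edges u).
Proof.
rewrite inE => /andP [eG sub]; have [a [b [ba eab]]] := edge_child eG.
have [eav|nav] := eqVneq a v; first by left; exists b; rewrite -?eav.
right; have av : a \in subtree v by rewrite (subsetP sub) // eab !inE eqxx.
have [u uv au] := subtree_child av nav; exists u => //.
rewrite inE eG /= eab; apply/subsetP => x; rewrite !inE in au *.
by case/orP => /eqP -> //; apply: connect_trans au; rewrite -(parent_child ba) fconnect1.
Qed.

(** * Non-overlapping sets of edges *)

Lemma overlap_sym : symmetric (overlap G).
Proof.
move=> e f; rewrite /overlap eq_sym setIC; congr [&& _, _ & _].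
by apply: eq_existsb => t; rewrite andbC.
Qed.

Lemma overlap_disjoint (e f : {set V}) : [disjoint e & f] -> ~~ overlap G e f.
Proof. by rewrite -setI_eq0 /overlap => ->; rewrite andbF. Qed.

Lemma nonoverlappingP (S : {set {set V}}) :
  reflect {in S &, forall e f, ~~ overlap G e f} (nonoverlapping G S).
Proof.
apply: (iffP 'forall_in_forall_inP) => H; first by move=> e f eS fS; apply: H.
by move=> e eS f fS; apply: H.
Qed.

Lemma nonoverlappingS (S S' : {set {set V}}) :
  S' \subset S -> nonoverlapping G S -> nonoverlapping G S'.
Proof.
move=> /subsetP sub /nonoverlappingP nov; apply/nonoverlappingP.
by move=> e f /sub eS /sub; apply: nov.
Qed.

Lemma nonoverlappingU (S S' : {set {set V}}) :
  nonoverlapping G S -> nonoverlapping G S' ->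
  (forall e f, e \in S -> f \in S' -> ~~ overlap G e f) ->
  nonoverlapping G (S :|: S').
Proof.
move=> /nonoverlappingP nS /nonoverlappingP nS' nSS'; apply/nonoverlappingP.
move=> e f; rewrite !inE => /orP [] eS /orP [] fS; [exact: nS|exact: nSS'| |exact: nS'].
by rewrite overlap_sym nSS'.
Qed.

Lemma nonoverlapping0 : nonoverlapping G set0.
Proof. by apply/nonoverlappingP => e f; rewrite inE. Qed.

(** The arguments of [overlap] come in the order used by [R0], whose condition on a child [u] is
    thus convertible to [avoids (M u) [set v; u]]. *)
Definition avoids (S : {set {set V}}) (e : {set V}) : bool :=
  [forall f in S, ~~ overlap G f e].

Lemma avoidsP (S : {set {set V}}) e :
  reflect {in S, forall f, ~~ overlap G f e} (avoids S e).
Proof. exact: 'forall_in_idP. Qed.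

Lemma avoidsS (S S' : {set {set V}}) e : S' \subset S -> avoids S e -> avoids S' e.
Proof. by move=> /subsetP sub /avoidsP av; apply/avoidsP => f /sub; apply: av. Qed.

(** A [Y] as in the second clause is itself of maximum cardinality: [X] must avoid [e] as soon as
    some maximum choice does. *)
Definition safe_maxNOS (S : {set {set V}}) (e : {set V}) (X : {set {set V}}) :=
  is_maxNOS G S X /\
  forall Y : {set {set V}}, Y \subset S -> nonoverlapping G Y -> avoids Y e ->
    #|X| <= #|Y| -> avoids X e.

Lemma safe_maxNOS0 e : safe_maxNOS set0 e set0.
Proof.
split; last by move=> *; apply/avoidsP => f; rewrite inE.
by split=> //; [exact: nonoverlapping0 | move=> Y; rewrite subset0 => /eqP ->].
Qed.

(** * One step of the algorithm *)

(* At the root there is no parent edge to protect. *)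
Definition good (v : V) (X : {set {set V}}) : Prop :=
  is_maxNOS G (subtree_edges v) X /\
  (v != r -> safe_maxNOS (subtree_edges v) [set v; par v] X).

Section Step.

Variables (maxNOS : {set {set V}} -> {set {set V}}) (tie : V -> bool).
Hypothesis maxNOSP : forall S : {set {set V}},
  S \subset edges G -> is_maxNOS G S (maxNOS S).

Variables (M : V -> {set {set V}}) (v : V).
Hypothesis goodM : forall u, u \in child G r v -> good u (M u).

Notation R0v := (R0 G r M v).
Notation Fv := (F G r maxNOS M v).
Notation T1v := (TM1 G r M v).
Notation eP := [set v; par v].

Lemma R0_sub : R0v \subset edges G.
Proof.
apply/subsetP => e /imsetP [u]; rewrite inE => /andP [uv _] ->.
exact: child_edge.
Qed.

Lemma mem_R0 u :
  u \in child G r v -> ([set v; u] \in R0v) = avoids (M u) [set v; u].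
Proof.
move=> uv; apply/imsetP/idP => [[w]|av]; last by exists u; rewrite // inE uv.
by rewrite inE => /andP [wv av] /(child_edge_inj uv wv) ->.
Qed.

Lemma parent_edge_notin_R0 : v != r -> eP \notin R0v.
Proof.
move=> nvr; apply/negP => /imsetP [u]; rewrite inE => /andP [uv _].
move=> /setP /(_ u); rewrite !inE eqxx orbT => /orP [] /eqP eu.
  by have := depth_child uv; rewrite eu => /n_Sn.
by have := depth_parent v; rewrite -eu (depth_child uv) ltnn.
Qed.

(** At the root [eP] is the singleton of [r], which is not an edge. *)
Lemma RP0_sub : v != r -> RP0 G r M v \subset edges G.
Proof.
move=> nvr; rewrite subUset R0_sub sub1set setUC.
exact/child_edge/child_parent.
Qed.

(** The size test detects safety. A larger [B] must contain [eP], and removing it leaves a maximum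
    choice that avoids [eP]. *)
Lemma F_maxNOS : is_maxNOS G R0v Fv /\ (v != r -> safe_maxNOS R0v eP Fv).
Proof.
rewrite /F; case: (eqVneq R0v set0) => [-> | nR0].
  by split=> [|_]; [case: (safe_maxNOS0 set0) | exact: safe_maxNOS0].
have maxA := maxNOSP R0_sub.
case: (eqVneq v r) => //= nvr.
have eP_R0 := parent_edge_notin_R0 nvr; move: (maxNOSP (RP0_sub nvr)).
set B := maxNOS (RP0 G r M v); set A := maxNOS R0v in maxA * => maxB.
case: maxA (maxA) => subA novA cardA maxA; case: maxB => subB novB cardB.
suff safe : safe_maxNOS R0v eP (if #|A| < #|B| then B :\ eP else A).
  by split; [case: safe | ].
have [ltAB | leBA] := ltnP #|A| #|B|.
  have BP : eP \in B.
    apply: contraTT ltAB => nBP; rewrite -leqNgt; apply: cardA => //.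
    apply/subsetP => e eB; have := subsetP subB e eB; rewrite !inE.
    by case/orP => // /eqP eeP; rewrite eeP (negPf nBP) in eB.
  split; last first.
    move=> *; apply/avoidsP => f; rewrite inE => /andP [_ fB].
    by move/nonoverlappingP: novB; apply.
  split.
  - apply/subsetP => e; rewrite !inE => /andP [neP /(subsetP subB)].
    by rewrite !inE (negPf neP) orbF.
  - exact: nonoverlappingS (subsetDl _ _) novB.
  - move=> Y subY novY; apply: leq_trans (cardA Y subY novY) _.
    by rewrite [#|B|](cardsD1 eP) BP in ltAB.
(* Here no safe [Y] can be as large as [A]: adding [eP] to it would beat [B]. *)
split=> // Y subY novY avY leAY.
have YP : eP \notin Y by apply: contra eP_R0; apply: (subsetP subY).
suff : #|eP |: Y| <= #|B|.
  by rewrite cardsU1 YP => leYB; have := leq_trans leYB (leq_trans leBA leAY);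
     rewrite ltnn.
apply: cardB; first by rewrite /RP0 setUC setSU.
rewrite setUC; apply: nonoverlappingU => //.
  apply/nonoverlappingP => e f; rewrite !inE => /eqP -> /eqP ->.
  by rewrite /overlap eqxx.
by move=> e f eY; rewrite inE => /eqP ->; move/avoidsP: avY; apply.
Qed.

Lemma M_sub u : u \in child G r v -> M u \subset subtree_edges u.
Proof. by case/goodM => [[]]. Qed.

Lemma subtree_edges_disjoint u w (e f : {set V}) :
  u \in child G r v -> w \in child G r v -> u != w ->
  e \in subtree_edges u -> f \in subtree_edges w -> [disjoint e & f].
Proof.
move=> uv wv nuw; rewrite !inE => /andP [_ eu] /andP [_ fw].
exact: disjointWl eu (disjointWr fw (subtree_disjoint uv wv nuw)).
Qed.

Lemma card_TM1 : #|T1v| = \sum_(u in child G r v) #|M u|.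
Proof.
apply: card_bigcup_disjoint => u w uv wv nuw; apply/pred0P => e /=; apply/negP => /andP [eu ew].
have eu' := subsetP (M_sub uv) e eu.
have := subtree_edges_disjoint uv wv nuw eu' (subsetP (M_sub wv) e ew).
(* A common edge would be disjoint from itself, hence empty, whereas edges have two nodes. *)
rewrite -setI_eq0 setIid => /eqP e0.
by have := edge_card (subsetP (subtree_edges_sub u) e eu'); rewrite e0 cards0.
Qed.

Lemma TM1_F_disjoint : [disjoint T1v & Fv].
Proof.
have [[subF _ _] _] := F_maxNOS.
apply/pred0P => e /=; apply/negP => /andP [/bigcupP [u uv eu]].
move=> /(subsetP subF) /imsetP [w _ ew].
have := subsetP (M_sub uv) e eu; rewrite ew => /child_edge_subtreeW.
by apply/negP/notin_subtree; rewrite (depth_child uv).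
Qed.

Lemma card_TM1_F : #|T1v :|: Fv| = #|T1v| + #|Fv|.
Proof. by apply/eqP; rewrite (eq_leqif (leq_card_setU _ _)) TM1_F_disjoint. Qed.

(** [Fv] is disjoint from [T1v], so [TM2] wins strictly unless [Fv] is empty. In that case [TM2] is
    [set0], and a tie forces [T1v] to be empty too. *)
Lemma node_matchingE : node_matching G r maxNOS tie M v = T1v :|: Fv.
Proof.
rewrite /node_matching /TM2; case: (eqVneq (child G r v) set0) => [noc | _].
  have R00 : R0v = set0.
    apply/setP => e; rewrite inE; apply/negP => /imsetP [u].
    by rewrite inE noc inE.
  by rewrite /F R00 eqxx setU0 /TM1 noc big_set0.
have [-> | nF] := eqVneq Fv set0.
  rewrite setU0 cards0 ltn0 card_gt0.
  by case: eqVneq => [-> | //]; case: (tie v).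
rewrite card_TM1_F ltnNge leq_addr /= -[X in X < _]addn0 ltn_add2l.
by rewrite card_gt0 nF.
Qed.

(** Edges below different children share no node; an edge [[set v; w]] of [Fv] can only meet edges
    of [M w], and membership in [R0v] excludes overlaps with those. *)
Lemma TM1_F_nonoverlapping : nonoverlapping G (T1v :|: Fv).
Proof.
have [[subF novF _] _] := F_maxNOS.
apply: nonoverlappingU => //.
  apply/nonoverlappingP => e f /bigcupP [u uv eu] /bigcupP [w wv fw].
  have [euw|nuw] := eqVneq u w.
    have [[_ /nonoverlappingP nov _] _] := goodM uv.
    by apply: nov => //; rewrite euw.
  apply/overlap_disjoint/(subtree_edges_disjoint uv wv nuw);
    [exact: subsetP (M_sub uv) e eu | exact: subsetP (M_sub wv) f fw].
move=> e f /bigcupP [u uv eu] /(subsetP subF) /imsetP [w].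
rewrite inE => /andP [wv /avoidsP avw] ->.
have [euw|nuw] := eqVneq w u; first by apply: avw; rewrite euw.
apply: overlap_disjoint; rewrite disjoint_sym.
have := subsetP (M_sub uv) e eu; rewrite inE => /andP [_ sub].
apply: disjointWr sub _; apply/pred0P => x /=; apply/negP; rewrite !inE.
case/andP => /orP [] /eqP ->; apply/negP.
  by have := @notin_subtree u v; rewrite inE (depth_child uv); apply.
by have := child_notin_subtree wv uv nuw; rewrite inE.
Qed.

Lemma card_subtree_matching (Y : {set {set V}}) :
  Y \subset subtree_edges v -> nonoverlapping G Y ->
  #|Y| <= #|T1v| + #|Y :&: R0v|.
Proof.
move=> subY novY.
(* Edges at [v] are counted through their lower endpoints, so that the two sides become sums over
   the children and can be compared term by term. *)
pose star := [set u in child G r v | [set v; u] \in Y].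
pose starR := [set u in child G r v | [set v; u] \in Y :&: R0v].
have leR : #|starR| <= #|Y :&: R0v|.
  rewrite -(card_in_imset (f := fun u => [set v; u]) (D := starR)).
    by apply/subset_leq_card/subsetP => e /imsetP [u]; rewrite inE => /andP [_ ?] ->.
  by move=> u w; rewrite !inE => /andP [uv _] /andP [wv _]; apply: child_edge_inj;
     rewrite ?inE.
have leY : #|Y| <= \sum_(u in child G r v) #|Y :&: subtree_edges u| + #|star|.
  have subU : Y \subset (\bigcup_(u in child G r v) (Y :&: subtree_edges u)) :|:
                        [set [set v; u] | u in star].
    apply/subsetP => e eY; rewrite inE; apply/orP.
    have [[u uv eu]|[u uv eu]] := subtree_edges_cases (subsetP subY e eY).
      by right; apply/imsetP; exists u; rewrite // inE uv -eu.
    by left; apply/bigcupP; exists u; rewrite // inE eY.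
  apply: leq_trans (subset_leq_card subU) _.
  apply: leq_trans (leq_card_setU _ _) _.
  exact: leq_add (leq_card_bigcup _ _) (leq_imset_card _ _).
apply: leq_trans leY _; rewrite card_TM1.
apply: leq_trans (leq_add (leqnn _) leR).
have cardE (P : pred V) :
    #|[set u in child G r v | P u]| = \sum_(u in child G r v) P u.
  by rewrite -sum1dep_card big_mkcondr; apply: eq_bigr => u _; case: (P u).
rewrite !cardE -!big_split leq_sum //= => u uv; rewrite inE mem_R0 //.
have [[_ _ maxMu] safeMu] := goodM uv.
have novYu : nonoverlapping G (Y :&: subtree_edges u).
  exact: nonoverlappingS (subsetIl _ _) novY.
have leYu : #|Y :&: subtree_edges u| <= #|M u| by apply: maxMu; rewrite ?subsetIr.
have [eY | _] := boolP ([set v; u] \in Y); last by rewrite /= !addn0.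
have [_ | nav] := boolP (avoids (M u) _); first by rewrite leq_add.
(* The trade: [[set v; u]] is in [Y] but overlaps [M u]. Were [Y :&: subtree_edges u] as large as
   [M u], it would be a safe maximum and force [M u] to avoid that edge. *)
rewrite /= addn1 addn0 ltnNge; apply: contra nav => leMY.
have nur : u != r by apply: contraTneq uv => ->; apply: root_notin_child.
have [_ safe] := safeMu nur; rewrite (parent_child uv) setUC in safe.
apply: safe leMY => //; first exact: subsetIr.
apply/avoidsP => f; rewrite inE => /andP [fY _].
by move/nonoverlappingP: novY; apply.
Qed.

Lemma good_node_matching : good v (node_matching G r maxNOS tie M v).
Proof.
rewrite node_matchingE.
have [[subF _ maxF] safeF] := F_maxNOS.
have max : is_maxNOS G (subtree_edges v) (T1v :|: Fv).
  split; last 1 first.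
  - move=> Y subY novY; rewrite card_TM1_F.
    apply: leq_trans (card_subtree_matching subY novY) _; rewrite leq_add2l.
    by apply: maxF; [exact: subsetIr | exact: nonoverlappingS (subsetIl _ _) novY].
  - rewrite subUset; apply/andP; split.
      apply/bigcupsP => u uv.
      exact: subset_trans (M_sub uv) (subtree_edges_child uv).
    apply: subset_trans subF _; apply/subsetP => e /imsetP [u].
    by rewrite inE => /andP [uv _] ->; apply: child_edge_subtree.
  - exact: TM1_F_nonoverlapping.
split=> // nvr; split=> // Y subY novY avY; rewrite card_TM1_F => leY.
have [_ safe] := safeF nvr.
(* By the counting bound, a safe maximum [Y] of the whole subtree leaves in [R0v] at least [#|Fv|]
   edges, all avoiding [eP]. *)
have /avoidsP avF : avoids Fv eP.
  apply: (safe (Y :&: R0v)); first exact: subsetIr.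
  - exact: nonoverlappingS (subsetIl _ _) novY.
  - exact: avoidsS (subsetIl _ _) avY.
  - by rewrite -(leq_add2l #|T1v|) (leq_trans leY) ?card_subtree_matching.
apply/avoidsP => f; rewrite inE => /orP [|/avF //].
case/bigcupP => u uv /(subsetP (M_sub uv)); rewrite inE => /andP [_ sub].
(* Edges of [T1v] lie strictly below [v], so they contain neither [v] nor its parent. *)
apply/overlap_disjoint/(disjointWl sub); rewrite disjoint_sym.
apply/pred0P => x /=; apply/negP => /andP []; rewrite in_set2.
case/orP => /eqP ->; apply/negP/notin_subtree; rewrite (depth_child uv) ltnS //.
exact: depth_parent.
Qed.

End Step.

(** * The run over all nodes *)

(** The invariant is that every node outside the remaining list is already good. Nodes still in the
    list after [v] are no deeper than [v], so the children of [v] are outside it. *)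
Lemma good_foldl (maxNOS : {set {set V}} -> {set {set V}}) (tie : V -> bool) :
  (forall S : {set {set V}}, S \subset edges G -> is_maxNOS G S (maxNOS S)) ->
  forall (s : seq V) (M : V -> {set {set V}}),
  sorted (fun u v => depth G r v <= depth G r u) s ->
  (forall u, u \notin s -> good u (M u)) ->
  forall u, good u (foldl (process G r maxNOS tie) M s u).
Proof.
move=> maxNOSP; elim=> [|v s IH] M /= pth goodM u; first exact: goodM.
apply: IH => [|w ws]; first exact: path_sorted pth.
rewrite /process; case: eqP => [-> | /eqP nwv]; last first.
  by apply: goodM; rewrite inE negb_or nwv.
apply: good_node_matching => // x xv; apply: goodM.
have trans : transitive (fun u v => depth G r v <= depth G r u).
  by move=> a b c ba ac; apply: leq_trans ac ba.
rewrite inE negb_or; apply/andP; split.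
  by apply/eqP => exv; have := depth_child xv; rewrite exv => /n_Sn.
apply/negP => xs; have /allP /(_ x xs) := order_path_min trans pth.
by rewrite (depth_child xv) ltnn.
Qed.

End RootedTree.

Theorem theorem2 (V : finType) (G : temporal_graph V) (r : V)
    (treeG : temporal_tree G)
    (single_interval : forall e, e \in edges G -> size (intervals G e) = 1)
    (maxNOS : {set {set V}} -> {set {set V}})
    (maxNOSP : forall S : {set {set V}},
       S \subset edges G -> is_maxNOS G S (maxNOS S))
    (tie : V -> bool)
    (s : seq V) (orderP : processing_order G r s) :
  maximum_timed_matching G (algorithmA G r maxNOS tie s).
Proof.
suff [sub nov max] : is_maxNOS G (edges G) (algorithmA G r maxNOS tie s).
  by split=> [|M' /andP [subM' novM']]; [apply/andP | apply: max].
rewrite -(subtree_edges_root r treeG) /algorithmA.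
have [perm_s sorted_s] := orderP.
case: eqVneq => [noc | _]; last first.
  have [] // := good_foldl treeG tie maxNOSP sorted_s (M := fun=> set0) _ r.
  (* Initially every node is in [s], so the invariant holds vacuously. *)
  by move=> u; rewrite (perm_mem perm_s) mem_enum.
(* If the root has no children, there are no edges at all. *)
suff -> : subtree_edges G r r = set0 by case: (safe_maxNOS0 G set0).
apply/setP => e; rewrite [RHS]inE; apply/negP.
by case/(subtree_edges_cases treeG) => [[u]|[u]]; rewrite noc inE.
Qed.
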